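(* Let $\lambda$ be a partition of $n$ and let $S$ be a filling of $\lambda$ with nonnegative integers that is semistandard (weakly increasing from left to right across rows and strictly increasing from bottom to top up columns). Then all elements of $B_\lambda^S=\{F_T^S : T\in\mathrm{SYT}(\lambda)\}$ are nonzero.
   Context: Young diagrams are in French notation (the first, largest part is the bottom row). $\mathrm{SYT}(\lambda)$ is the set of standard Young tableaux of shape $\lambda$ (entries $1,\dots,n$, increasing along rows and up columns). $\mathfrak S_n$ acts on $\mathbb{C}[x_1,\dots,x_n]$ by $\sigma x_i=x_{\sigma(i)}$. $\mathcal R(T),\mathcal C(T)\subseteq\mathfrak S_n$ are the subgroups preserving the set of entries of each row, respectively column, of $T$, and $\varepsilon_T=\sum_{\tau\in\mathcal C(T)}\sum_{\sigma\in\mathcal R(T)}(-1)^\tau\,\tau\sigma$. Put $\mathbf{x}_T^S=\prod_{b\in\lambda}x_{T(b)}^{S(b)}$ (over boxes $b$ of $\lambda$) and $F_T^S=\varepsilon_T\mathbf{x}_T^S\in\mathbb{C}[x_1,\dots,x_n]$. *)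

(* Defs.v *)
From mathcomp Require Import all_boot all_order all_fingroup all_algebra.
From mathcomp Require Import reals complex mpoly.

Set Implicit Arguments.
Unset Strict Implicit.
Unset Printing Implicit Defensive.

Import GRing.Theory.
Local Open Scope ring_scope.

Definition is_partition (n : nat) (lam : seq nat) : bool :=
  [&& sorted geq lam, 0%N \notin lam & sumn lam == n].

(* French notation, 0-indexed: row 0 is the bottom row, and it has
   [nth 0 lam 0] boxes, the largest part. *)
Definition box (lam : seq nat) : finType :=
  {i : 'I_(size lam) & 'I_(nth 0%N lam i)}.

Definition box_row (lam : seq nat) (b : box lam) : nat := tag b.
Definition box_col (lam : seq nat) (b : box lam) : nat := tagged b.

Definition semistandard (lam : seq nat) (S : box lam -> nat) : Prop :=
  (forall b c : box lam,
     box_row b = box_row c -> (box_col b < box_col c)%N -> (S b <= S c)%N) /\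
  (forall b c : box lam,
     box_col b = box_col c -> (box_row b < box_row c)%N -> (S b < S c)%N).

(* The entries 1, ..., n are represented by the elements 0, ..., n - 1 of
   ['I_n], which also index the variables of [{mpoly K[n]}]. *)
Definition SYT (n : nat) (lam : seq nat) : {set {ffun box lam -> 'I_n}} :=
  [set T : {ffun box lam -> 'I_n} |
    [&& [forall k : 'I_n, #|[set b | T b == k]| == 1%N],
        [forall b, forall c,
           (box_row b == box_row c) && (box_col b < box_col c)%N
           ==> (T b < T c)%N]
      & [forall b, forall c,
           (box_col b == box_col c) && (box_row b < box_row c)%N
           ==> (T b < T c)%N]]].

Section SpechtPolynomials.

Variables (K : comNzRingType) (n : nat) (lam : seq nat).
Implicit Types (S : box lam -> nat) (T : {ffun box lam -> 'I_n}).

Definition row_entries T (i : nat) : {set 'I_n} :=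
  [set T b | b : box lam & box_row b == i].
Definition col_entries T (j : nat) : {set 'I_n} :=
  [set T b | b : box lam & box_col b == j].

(* Quantifying over the boxes [b] covers exactly the nonempty rows (columns). *)
Definition row_group T : {set 'S_n} :=
  [set s : 'S_n | [forall b : box lam,
     s @: row_entries T (box_row b) == row_entries T (box_row b)]].
Definition col_group T : {set 'S_n} :=
  [set s : 'S_n | [forall b : box lam,
     s @: col_entries T (box_col b) == col_entries T (box_col b)]].

(* [msym s] is the action with s x_i = x_{s i}.  The product tau sigma in the
   group algebra acts by sigma first; it is written as a composition of actions
   because [(tau * sigma)%g] in ['S_n] would apply tau first. *)
Definition young_symmetrizer T (p : {mpoly K[n]}) : {mpoly K[n]} :=
  \sum_(tau in col_group T) \sum_(sigma in row_group T)
     (-1) ^+ tau *: msym tau (msym sigma p).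

Definition xmonom T S : {mpoly K[n]} :=
  \prod_(b : box lam) 'X_(T b) ^+ S b.

Definition specht_poly T S : {mpoly K[n]} :=
  young_symmetrizer T (xmonom T S).

Definition specht_family S : seq {mpoly K[n]} :=
  [seq specht_poly T S | T in SYT n lam].

End SpechtPolynomials.

(* Main.v *)
Require Import Defs.
From mathcomp Require Import all_boot all_order all_fingroup all_algebra.
From mathcomp Require Import reals complex mpoly.

(** Let [w] be the exponent vector of the monomial x_T^S.  The polynomial
    F_T^S is nonzero because its coefficient at x_T^S itself is a positive
    integer.  Indeed this coefficient is the sum of (-1)^tau over the pairs
    (tau, sigma), tau a column permutation and sigma a row permutation of [T],
    for which tau sigma fixes [w]; and in such a pair tau must be the identity
    ([column_perm_eq1]).  Hence all the signs are +1 and the coefficient counts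
    the row permutations fixing x_T^S ([mcoeff_specht_poly]), of which the
    identity is one.

    That tau is the identity follows by induction on the value [v]: suppose
    that tau fixes every entry of weight less than [v].  The inverse of tau
    moves an entry of weight [v] within its column to one of weight at least
    [v], hence, as [S] increases strictly up columns, to a row that is at least
    as high.  On the other hand, since sigma preserves rows and tau sigma
    preserves weights, the sum of the row indices over the entries of weight
    [v] does not change.  So no such entry changes row, and tau fixes all of
    them. *)

Import GRing.Theory.
Local Open Scope ring_scope.

(** In this lemma [r i], [c i] and [w i] stand for the row, the column and the
    weight of the entry [i]. *)
Lemma column_perm_eq1 (I : finType) (r c w : I -> nat) (s t : {perm I}) :
  (forall i j, c i = c j -> r i = r j -> i = j) ->
  (forall i j, c i = c j -> (r i < r j)%N -> (w i < w j)%N) ->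
  (forall i, r (s i) = r i) -> (forall i, c (t i) = c i) ->
  (forall i, w (t (s i)) = w i) -> t = 1%g.
Proof.
move=> rc_inj w_strict rs ct wts.
have ctV i : c (t^-1%g i) = c i by rewrite -(ct (t^-1%g i)) permKV.
suff tV1 v i : w i = v -> t^-1%g i = i.
  by apply/permP=> i; rewrite perm1 -[in LHS](tV1 _ i erefl) permKV.
elim/ltn_ind: v i => v IHv i wi.
have le_w k : w k = v -> (v <= w (t^-1%g k))%N.
  move=> wk; rewrite leqNgt; apply/negP=> lt_v.
  have tVk : t^-1%g k = k by apply: (@perm_inj _ t^-1%g); apply: (IHv _ lt_v).
  by rewrite tVk wk ltnn in lt_v.
have le_r k : w k == v ->
    (r k <= r (t^-1%g k) ?= iff (r k == r (t^-1%g k)))%N.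
  move=> /eqP wk; split=> //; rewrite leqNgt; apply/negP=> lt_r.
  have := w_strict _ _ (ctV k) lt_r.
  by rewrite wk ltnNge le_w.
have sum_r : (\sum_(k | w k == v) r (t^-1%g k) = \sum_(k | w k == v) r k)%N.
  rewrite (reindex_inj (@perm_inj _ t)) /=.
  rewrite (reindex_inj (@perm_inj _ s)) /=.
  by apply: eq_big => k; rewrite ?wts // permK rs.
have [_ /esym] := leqif_sum le_r.
rewrite sum_r eqxx => /forall_inP/(_ i); rewrite wi eqxx => /(_ isT) /eqP eq_r.
by apply: rc_inj; rewrite ?ctV.
Qed.

Section Coefficient.

Variables (n : nat) (lam : seq nat).
Implicit Types (S : box lam -> nat) (T : {ffun box lam -> 'I_n}).

Lemma box_inj (b c : box lam) :
  box_col b = box_col c -> box_row b = box_row c -> b = c.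
Proof.
case: b c => [i j] [i' j']; rewrite /box_col /box_row /= => eq_j /val_inj eq_i.
by case: i' / eq_i j' eq_j => j' /val_inj ->.
Qed.

Lemma SYT_bij T : T \in SYT n lam -> bijective T.
Proof.
rewrite inE => /and3P[/forallP T1 _ _].
have [V VT] : exists V, forall k, [set b | T b == k] = [set V k].
  have T1' k : exists b, [set b | T b == k] = [set b] by apply/cards1P.
  exact: (fin_all_exists T1').
exists V => [b | k].
  by have /setP/(_ b) := VT (T b); rewrite !inE eqxx => /esym/eqP.
by have /setP/(_ (V k)) := VT k; rewrite !inE eqxx => /eqP.
Qed.

(** The exponent of x_k in x_T^S: the sum has the single term S(T^-1(k)) when
    [T] is a bijection. *)
Definition xexponent T S : 'X_{1..n} :=
  [multinom (\sum_(b | T b == k) S b)%N | k < n].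

Lemma xexponentE T S b : injective T -> xexponent T S (T b) = S b.
Proof.
by move=> T_inj; rewrite mnmE (eq_bigl _ _ (inj_eq T_inj ^~ b)) big_pred1_eq.
Qed.

Lemma xmonomE (K : comNzRingType) T S : xmonom K T S = 'X_[xexponent T S].
Proof.
rewrite mpolyXE_id /xmonom (partition_big T predT) //=.
apply: eq_bigr => k _; rewrite mnmE expr_sum.
by apply: eq_bigr => b /eqP ->.
Qed.

Lemma row_group_box_row T V s k : cancel T V -> cancel V T ->
  s \in row_group T -> box_row (V (s k)) = box_row (V k).
Proof.
move=> TK VK; rewrite inE => /forallP/(_ (V k)) /eqP s_row.
have : s k \in s @: row_entries T (box_row (V k)).
  by rewrite imset_f // -[X in X \in _]VK imset_f // inE.
by rewrite s_row => /imsetP[b]; rewrite inE => /eqP <- ->; rewrite TK.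
Qed.

Lemma col_group_box_col T V t k : cancel T V -> cancel V T ->
  t \in col_group T -> box_col (V (t k)) = box_col (V k).
Proof.
move=> TK VK; rewrite inE => /forallP/(_ (V k)) /eqP t_col.
have : t k \in t @: col_entries T (box_col (V k)).
  by rewrite imset_f // -[X in X \in _]VK imset_f // inE.
by rewrite t_col => /imsetP[b]; rewrite inE => /eqP <- ->; rewrite TK.
Qed.

Lemma row_group1 T : 1%g \in row_group T.
Proof.
by rewrite inE; apply/forallP=> b; rewrite (eq_imset _ (@perm1 _)) imset_id.
Qed.

Lemma col_group1 T : 1%g \in col_group T.
Proof.
by rewrite inE; apply/forallP=> b; rewrite (eq_imset _ (@perm1 _)) imset_id.
Qed.

(** Over any commutative ring, and for any filling that increases strictly up
    the columns, the coefficient of x_T^S in F_T^S is the number of row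
    permutations of [T] that fix x_T^S. *)
Lemma mcoeff_specht_poly (K : comNzRingType) T S (w := xexponent T S) :
  bijective T ->
  (forall b c : box lam,
     box_col b = box_col c -> (box_row b < box_row c)%N -> (S b < S c)%N) ->
  (specht_poly K T S)@_w
    = #|[set s in row_group T | [forall k, w (s k) == w k]]|%:R.
Proof.
move=> T_bij S_strict; have [V TK VK] := T_bij.
have wE k : w k = S (V k).
  by rewrite -[in LHS](VK k) xexponentE //; apply: bij_inj.
rewrite /specht_poly /young_symmetrizer xmonomE -/w raddf_sum /=; clearbody w.
have coefE (t s : 'S_n) : ((-1) ^+ t *: msym t (msym s 'X_[w]))@_w
    = (-1) ^+ t * [forall k, w (t (s k)) == w k]%:R :> K.
  rewrite mcoeffZ !mcoeff_sym mcoeffX; congr (_ * _%:R); congr nat_of_bool.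
  apply/eqP/forallP => [/mnmP eq_w k | eq_w].
    by have := eq_w k; rewrite !mnmE => ->.
  by apply/mnmP=> k; rewrite !mnmE; apply/esym/eqP.
rewrite (bigD1 1%g) ?col_group1 //= [X in _ + X]big1 ?addr0.
  rewrite raddf_sum -sum1dep_card natr_sum big_mkcondr /=.
  apply: eq_bigr => s _; rewrite coefE odd_perm1 expr0 mul1r.
  under eq_forallb do rewrite perm1.
  by case: ifP.
move=> t /andP[t_col t_neq1]; rewrite raddf_sum big1 //= => s s_row.
rewrite coefE; case: forallP => [fix_w | _]; last by rewrite mulr0.
case/eqP: t_neq1.
apply: (@column_perm_eq1 _ (fun k => box_row (V k))
                           (fun k => box_col (V k)) w s t).
- by move=> i j eq_c eq_r; apply: (can_inj VK); apply: box_inj.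
- by move=> i j; rewrite !wE; apply: S_strict.
- by move=> k; apply: row_group_box_row.
- by move=> k; apply: col_group_box_col.
- by move=> k; apply/eqP.
Qed.

End Coefficient.

Theorem corollary1p14 (R : realType) (n : nat) (lam : seq nat)
    (lam_part : is_partition n lam)
    (S : box lam -> nat) (S_semistd : semistandard S) :
  forall F : {mpoly R[i][n]}, F \in specht_family R[i] n S -> F != 0.
Proof.
move=> F /mapP[T]; rewrite mem_enum => /SYT_bij T_bij ->.
apply/negP=> /eqP F0.
have := @mcoeff_specht_poly _ _ R[i] T S T_bij (proj2 S_semistd).
rewrite F0 mcoeff0 => /esym/eqP; rewrite Num.Theory.pnatr_eq0 => /eqP card0.
have := in_set0 (1%g : 'S_n); rewrite -(cards0_eq card0) inE row_group1 /=.
by move/forallP; case=> k; rewrite perm1.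
Qed.
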